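(* Let $k\geq 4$ be an integer. Let $G$ and $H$ be connected graphs on the same vertex set $V$ with $|V|\geq 2k-1$, neither of which contains a cycle of length $\ell$ for any $3\leq \ell\leq k$. If $G$ and $H$ have the same family of connected $k$-sets, then $G=H$.
   Context: For a graph $G=(V,E)$ and $k\geq 2$, the connected $k$-sets are the sets $X\subseteq V$ with $|X|=k$ such that $G[X]$ is connected. Graphs are finite, simple and labelled: equality means equal edge sets. *)

(* Defs.v *)
From mathcomp Require Import all_boot.
Set Implicit Arguments.
Unset Strict Implicit.
Unset Printing Implicit Defensive.

(* The well-formedness proof is a boolean equality, hence irrelevant: Leibniz
   equality of sgraphs is equality of edge sets. *)
Record sgraph (V : finType) : Type := SGraph {
  edges : {set {set V}};
  edges_card2 : [forall e in edges, #|e| == 2]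
}.

Definition adj (V : finType) (G : sgraph V) : rel V :=
  fun x y => [set x; y] \in edges G.

Definition induced_adj (V : finType) (G : sgraph V) (X : {set V}) : rel V :=
  fun x y => [&& x \in X, y \in X & adj G x y].

(* Connectedness of G[X]; the empty graph is not connected. *)
Definition induced_connected (V : finType) (G : sgraph V) (X : {set V}) : bool :=
  (X != set0) && [forall x in X, forall y in X, connect (induced_adj G X) x y].

Definition connected_graph (V : finType) (G : sgraph V) : bool :=
  induced_connected G [set: V].

Definition connected_ksets (V : finType) (G : sgraph V) (k : nat) : {set {set V}} :=
  [set X : {set V} | (#|X| == k) && induced_connected G X].

(* Cycles are subgraphs, not necessarily induced. Meaningful for l >= 3 only:
   for l = 2 a single edge would qualify. *)
Definition has_cycle_of_length (V : finType) (G : sgraph V) (l : nat) : Prop :=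
  exists c : seq V, size c = l /\ ucycle (adj G) c.

(* Main.v *)
Require Import Defs.
From mathcomp Require Import all_boot.
From mathcomp Require Import zify.
Set Implicit Arguments.
Unset Strict Implicit.
Unset Printing Implicit Defensive.

(* Every edge of G[X] lies in a connected k-subset of X, so G and H have the same
   connected sets of every size >= k.

   If both graphs are trees, choose a vertex r such that, for every b <> r, the
   component of r in G - b has at least k vertices; it exists because
   #|V| >= 2k - 1. This component is the largest connected set containing r but
   not b, hence is the same in H, and these components determine the parent of
   every vertex in the tree rooted at r.

   Otherwise take a cycle c that is shortest among the cycles of both graphs, say
   in G, of length m > k. A vertex outside a connected set D has at most one
   neighbour in D as soon as #|D| + 1 < m; this forces c to be a cycle of H too
   (deleting two consecutive vertices of c leaves a connected set, of size >= k if
   m >= k + 2; for m = k + 1 a pendant vertex is added). The agreement of G and H on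
   c then propagates to the whole graph one vertex at a time. *)

(** * Connected sets and components in one graph *)

Section OneGraph.
Variables (V : finType) (G : sgraph V).
Implicit Types (x y z a b v w s t : V) (X Y S D : {set V}) (c p q : seq V).

Lemma adj_sym : symmetric (adj G).
Proof. by move=> x y; rewrite /adj setUC. Qed.

Lemma adj_neq x y : adj G x y -> x != y.
Proof.
move=> axy; have := forall_inP (edges_card2 G) _ axy.
by rewrite cards2 eqSS; case: (x != y).
Qed.

Lemma induced_connect_sym X : connect_sym (induced_adj G X).
Proof.
apply: sym_connect_sym => x y.
by rewrite /induced_adj adj_sym andbCA.
Qed.

Lemma induced_connectedP X :
  reflect (X != set0 /\ {in X &, forall x y, connect (induced_adj G X) x y})
          (induced_connected G X).
Proof.
apply: (iffP andP) => -[X0 cX]; split=> //.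
  by move=> x y xX yX; apply: (forall_inP (forall_inP cX x xX)).
by apply/forall_inP => x xX; apply/forall_inP => y yX; apply: cX.
Qed.

Lemma induced_connected_root X x :
  x \in X -> {in X, forall y, connect (induced_adj G X) x y} ->
  induced_connected G X.
Proof.
move=> xX cX; apply/induced_connectedP; split; first by apply/set0Pn; exists x.
move=> y z yX zX; apply: connect_trans (cX z zX).
by rewrite induced_connect_sym cX.
Qed.

Lemma sub_connect_induced X Y x y :
  X \subset Y -> connect (induced_adj G X) x y -> connect (induced_adj G Y) x y.
Proof.
move/subsetP => sXY; apply: connect_sub => a b /and3P[aX bX ab].
by apply: connect1; rewrite /induced_adj !sXY.
Qed.

Lemma induced_connected1 x : induced_connected G [set x].
Proof.
by apply: (@induced_connected_root _ x) => [|y]; rewrite inE // => /eqP->.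
Qed.

Lemma induced_connectedU1 S s t :
  induced_connected G S -> s \in S -> adj G s t -> induced_connected G (t |: S).
Proof.
move=> /induced_connectedP[_ cS] sS st.
have sub : S \subset t |: S by apply: subsetUr.
apply: (@induced_connected_root _ s) => [|y]; first by rewrite inE sS orbT.
rewrite in_setU1 => /orP[/eqP->|yS].
  by apply: connect1; rewrite /induced_adj !inE eqxx sS orbT.
exact: sub_connect_induced sub (cS _ _ sS yS).
Qed.

(** Follow a path of [G[X]] from a vertex of [S] to a vertex of [X] outside [S] until it first
    leaves [S]. *)
Lemma crossing_edge X S :
  induced_connected G X -> S \subset X -> S != set0 -> S != X ->
  exists s t, [/\ s \in S, t \in X, t \notin S & adj G s t].
Proof.
move=> /induced_connectedP[_ cX] sSX /set0Pn[s sS] nSX.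
have /subsetPn[t tX tS] : ~~ (X \subset S).
  by apply: contra nSX => sXS; rewrite eqEsubset sSX.
have /connectP[p pp et] := cX _ _ (subsetP sSX _ sS) tX.
elim: p s sS pp et => [|y p IHp] s sS /=.
  by move=> _ et; rewrite et sS in tS.
move=> /andP[/and3P[sX yX sy] pp] et.
have [yS|yS] := boolP (y \in S); first exact: IHp yS pp et.
by exists s, y.
Qed.

Lemma nbr_in_connected X x :
  induced_connected G X -> x \in X -> 1 < #|X| ->
  exists2 y, y \in X & adj G x y.
Proof.
move=> cX xX X1.
have [||| s [t [/set1P-> tX _ xt]]] := @crossing_edge X [set x] cX.
- by rewrite sub1set.
- by apply/set0Pn; exists x; rewrite inE.
- by apply: contraTneq X1 => <-; rewrite cards1.
by exists t.
Qed.

Lemma grow_connected X S m :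
  induced_connected G X -> induced_connected G S -> S \subset X ->
  #|S| <= m <= #|X| ->
  exists Y, [/\ S \subset Y, Y \subset X, #|Y| = m & induced_connected G Y].
Proof.
move=> cX; move Ed: (m - #|S|) => d.
elim: d S Ed => [|d IHd] S Ed cS sSX /andP[Sm mX].
  by exists S; split=> //; lia.
have [||s [t [sS tX tS st]]] := crossing_edge cX sSX.
- by have /induced_connectedP[] := cS.
- by apply: contraTneq mX => <-; lia.
have ctS := induced_connectedU1 cS sS st.
have cardtS : #|t |: S| = #|S|.+1 by rewrite cardsU1 tS.
have [|||Y [sY YX Ym cY]] := IHd (t |: S) _ ctS.
- by lia.
- by rewrite subUset sub1set tX.
- by rewrite cardtS; lia.
by exists Y; split=> //; apply: subset_trans sY; apply: subsetUr.
Qed.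

(** For [x] outside [X] this is the singleton of [x], as [connect] is reflexive. *)
Definition component X x : {set V} := [set y | connect (induced_adj G X) x y].

Lemma component_refl X x : x \in component X x.
Proof. by rewrite inE. Qed.

Lemma component_sub X x : x \in X -> component X x \subset X.
Proof.
move=> xX; apply/subsetP => y; rewrite inE => /connectP[p pp ->].
elim: p x xX pp => //= z p IHp x xX /andP[/and3P[_ zX _] pp].
exact: IHp zX pp.
Qed.

Lemma component_closed X x y z :
  x \in X -> y \in component X x -> z \in X -> adj G y z -> z \in component X x.
Proof.
move=> xX yC zX yz; have yX := subsetP (component_sub xX) _ yC.
move: yC; rewrite !inE => xy; apply: connect_trans xy _.
by apply: connect1; rewrite /induced_adj yX zX.
Qed.

(** Each prefix of a walk from [x] in [G[X]] ends in the component, so every edge of the walk lies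
    inside it. *)
Lemma component_connected X x : x \in X -> induced_connected G (component X x).
Proof.
move=> xX; apply: (@induced_connected_root _ x) => [|y]; first exact: component_refl.
rewrite inE => /connectP[p]; elim/last_ind: p y => [|p z IHp] y /=.
  by move=> _ ->.
rewrite rcons_path last_rcons => /andP[pp lz] ->.
apply: connect_trans (IHp _ pp erefl) _; apply: connect1.
have lC : last x p \in component X x by rewrite inE; apply/connectP; exists p.
case/and3P: lz => _ zX lz.
by rewrite /induced_adj lC lz (component_closed xX lC zX lz).
Qed.

Lemma component_max X Y x :
  induced_connected G Y -> x \in Y -> Y \subset X -> Y \subset component X x.
Proof.
move=> /induced_connectedP[_ cY] xY sYX; apply/subsetP => y yY.
by rewrite inE; apply: sub_connect_induced sYX _; apply: cY.
Qed.

(** * Paths, cycles and girth in one graph *)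

Lemma path_connected x p : path (adj G) x p -> induced_connected G [set y in x :: p].
Proof.
elim/last_ind: p => [_|p z IHp].
  by rewrite (_ : [set _ in _] = [set x]) ?induced_connected1 //; apply/setP => y; rewrite !inE.
rewrite rcons_path => /andP[/IHp cp lz].
rewrite (_ : [set _ in _] = z |: [set y in x :: p]).
  by apply: induced_connectedU1 cp _ lz; rewrite inE mem_last.
by apply/setP => y; rewrite !inE mem_rcons inE orbCA.
Qed.

(** A simple path from [w] to [w'] in [D] closes up through [a]. *)
Lemma two_nbr_cycle D a w w' :
  induced_connected G D -> a \notin D -> w \in D -> w' \in D -> w != w' ->
  adj G a w -> adj G a w' ->
  exists c, [/\ ucycle (adj G) c, 3 <= size c <= #|D|.+1 & {subset c <= a |: D}].
Proof.
move=> /induced_connectedP[_ cD] aD wD w'D ww' aw aw'.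
have /connectP[p0 pp0] := cD _ _ wD w'D.
case/shortenP: pp0 => p pp up _ elast.
have pD : {subset w :: p <= D}.
  move=> y; rewrite inE => /predU1P[->//|].
  elim: p w {up ww' aw elast} wD pp => //= z p IHp w wD /andP[/and3P[_ zD _] pp].
  by rewrite inE => /predU1P[->//|]; apply: IHp pp.
have up' : uniq [:: a, w & p].
  by rewrite cons_uniq up andbT; apply: contra aD => /pD.
exists [:: a, w & p]; split.
- rewrite /ucycle up' andbT /= rcons_path -elast (adj_sym w') aw' andbT aw /=.
  by apply: sub_path pp => x y /and3P[].
- have -> : #|D|.+1 = #|a |: D| by rewrite cardsU1 aD.
  rewrite -(card_uniqP up'); apply/andP; split; last first.
    apply: subset_leq_card; apply/subsetP => y; rewrite inE => /predU1P[->|/pD yD].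
      by rewrite setU11.
    by rewrite inE yD orbT.
  rewrite (card_uniqP up'); case: p {pp up up' pD} elast => //= e.
  by rewrite e eqxx in ww'.
- by move=> y; rewrite !inE => /predU1P[->|/pD->]; rewrite ?eqxx ?orbT.
Qed.

(** Girth at least [m]. Cycles have distinct vertices, so [m = #|V|.+1] expresses that the graph is
    acyclic. *)
Definition cycles_ge (m : nat) : Prop :=
  forall l, 3 <= l < m -> ~ has_cycle_of_length G l.

Lemma cycles_ge_size m c : cycles_ge m -> ucycle (adj G) c -> 3 <= size c -> m <= size c.
Proof.
move=> gm uc c3; rewrite leqNgt; apply/negP => cm.
by case: (gm (size c)); rewrite ?c3 //; exists c.
Qed.

Lemma cycles_ge_unique_nbr m D a w w' :
  cycles_ge m -> induced_connected G D -> #|D|.+1 < m -> a \notin D ->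
  w \in D -> w' \in D -> adj G a w -> adj G a w' -> w = w'.
Proof.
move=> gm cD Dm aD wD w'D aw aw'; apply/eqP; apply: contraLR Dm => ww'.
have [c [uc /andP[c3 cD1] _]] := two_nbr_cycle cD aD wD w'D ww' aw aw'.
by rewrite -leqNgt; apply: leq_trans cD1; apply: cycles_ge_size.
Qed.

Lemma ucycle_path a p y q : p = y :: q -> ucycle (adj G) (a :: p) -> path (adj G) y q.
Proof.
move=> -> /andP[/= /andP[_]].
by rewrite rcons_path => /andP[].
Qed.

Lemma ucycle_rot_to c a :
  ucycle (adj G) c -> a \in c ->
  exists p, [/\ ucycle (adj G) (a :: p), a :: p =i c & size (a :: p) = size c].
Proof.
move=> uc /rot_to[i p rc]; exists p; rewrite -rc rot_ucycle size_rot.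
by split=> // y; rewrite mem_rot.
Qed.

Lemma ucycle_connected c : ucycle (adj G) c -> 0 < size c -> induced_connected G [set y in c].
Proof.
case: c => // a p /andP[/=]; rewrite rcons_path => /andP[pp _] _ _.
exact: path_connected pp.
Qed.

Lemma ucycle_del1 c a :
  ucycle (adj G) c -> 1 < size c -> induced_connected G ([set y in c] :\ a).
Proof.
move=> uc c1; have [ac|ac] := boolP (a \in c); last first.
  suff -> : [set y in c] :\ a = [set y in c] by apply: ucycle_connected => //; lia.
  apply/setP => y; rewrite !inE; case: eqP => //= ->.
  by rewrite (negbTE ac).
have [p [up ep sp]] := ucycle_rot_to uc ac.
case: p up ep sp => [|y q] up ep sp; first by rewrite -sp in c1.
suff -> : [set y in c] :\ a = [set z in y :: q].
  exact: path_connected (ucycle_path erefl up).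
have /andP[_ /andP[ayq _]] := up.
apply/setP => z; rewrite !inE -ep !inE; case: eqP => [->|] //=.
by move: ayq; rewrite inE => /negbTE.
Qed.

(** Rotating [a], [b] to the front leaves the path [p2 ++ p1], which is nonempty; the empty set does
    not count as connected. *)
Lemma ucycle_del2 p1 a b p2 :
  ucycle (adj G) (p1 ++ [:: a, b & p2]) -> 0 < size (p1 ++ p2) ->
  induced_connected G ([set y in p1 ++ [:: a, b & p2]] :\: [set a; b]).
Proof.
rewrite -(rot_ucycle (size p1)) rot_size_cat /= => uc.
have /andP[_ /= /and3P[]] := uc.
rewrite inE => /norP[ab ap] bp _ s0.
case Ep: (p2 ++ p1) uc ap bp => [|y q] uc ap bp.
  by move: s0; rewrite size_cat addnC -size_cat Ep.
suff -> : [set y in p1 ++ [:: a, b & p2]] :\: [set a; b] = [set z in y :: q].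
  by have /= /andP[_] := ucycle_path erefl uc; apply: path_connected.
apply/setP => z; rewrite -Ep !inE !mem_cat !inE.
case: (eqVneq z a) => [->|] /=.
  by move: ap; rewrite -Ep mem_cat => /negbTE.
case: (eqVneq z b) => [->|] /=.
  by move: bp; rewrite -Ep mem_cat => /negbTE.
by rewrite orbC.
Qed.

Lemma ucycle_unique_nbr m c v w w' :
  cycles_ge m -> 4 < m -> ucycle (adj G) c -> size c = m -> v \notin c ->
  w \in c -> w' \in c -> adj G v w -> adj G v w' -> w = w'.
Proof.
move=> gm m4 uc cm vc wc w'c vw vw'; apply/eqP; apply/negPn/negP => ww'.
have [p [up ep sp]] := ucycle_rot_to uc wc.
have w'p : w' \in p by move: w'c; rewrite -ep inE eq_sym (negbTE ww').
have [p1 [p2 Ep]] : exists p1 p2 : seq V, p = p1 ++ w' :: p2.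
  by case/splitPr: w'p => p1 p2; exists p1, p2.
subst p.
have szp : size p1 + size p2 + 2 = m by rewrite -cm -sp /= size_cat /=; lia.
(* The two arcs between w and w' have m + 2 vertices in total, so the shorter
   one closes up through v to a cycle of length < m. *)
suff [D [Dp Dm wD w'D]] : exists D : seq V, [/\ exists x q, D = x :: q /\ path (adj G) x q,
    size D <= m - 2 /\ {subset D <= c}, w \in D & w' \in D].
  case: Dp => x [q [ED /path_connected]]; rewrite -ED => cD.
  case: Dm => Dm sDc.
  have cardD : #|[set y in D]| <= size D.
    by rewrite cardsE; apply: card_size.
  move/eqP: ww'; apply.
  apply: (cycles_ge_unique_nbr gm cD _ _ _ _ vw vw'); rewrite ?inE //; first by lia.
  by apply: contra vc => /sDc.
(* If [p2] has at least two vertices, the arc through [p1] has at most [m - 2]; otherwise the arc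
   through [p2] has at most 3, and [4 < m]. *)
have [big|small] := leqP 2 (size p2).
  exists (w :: rcons p1 w'); split; rewrite ?mem_head ?inE ?mem_rcons ?mem_head ?orbT //.
    exists w, (rcons p1 w'); split=> //; move: up => /andP[/= ].
    rewrite rcons_cat cat_path => /andP[pp1 /= /andP[lw' _]] _.
    by rewrite rcons_path pp1.
  split; first by rewrite /= size_rcons; lia.
  by move=> y yc; rewrite -ep; move: yc; rewrite !inE mem_rcons mem_cat !inE => /or3P[]->; rewrite ?orbT.
exists (w' :: rcons p2 w); split; rewrite ?mem_head ?inE ?mem_rcons ?mem_head ?orbT //.
  exists w', (rcons p2 w); split=> //; move: up => /andP[/= ].
  by rewrite rcons_cat cat_path => /andP[_ /= /andP[_]].
split; first by rewrite /= size_rcons; lia.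
by move=> y yc; rewrite -ep; move: yc; rewrite !inE mem_rcons mem_cat !inE => /or3P[]->; rewrite ?orbT.
Qed.

(** [a] has a neighbour [w] in [X] and another one in [X :\ w], which is still connected. *)
Lemma two_nbrs X a :
  induced_connected G X -> (forall y, induced_connected G (X :\ y)) ->
  2 < #|X| -> a \in X ->
  exists w w', [/\ w \in X, w' \in X, w != w', adj G a w & adj G a w'].
Proof.
move=> cX cXd X2 aX.
have [|w wX aw] := nbr_in_connected cX aX; first by lia.
have cardXw : #|X| = #|X :\ w|.+1 by rewrite (cardsD1 w X) wX.
have [||w'] := nbr_in_connected (x := a) (cXd w).
- by rewrite !inE aX adj_neq.
- by lia.
rewrite !inE => /andP[w'w w'X] aw'.
by exists w, w'; rewrite eq_sym.
Qed.

(* Otherwise a would have two neighbours in the connected set X :\: [set a; b],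
   closing up to a cycle with fewer than #|X| vertices. *)
Lemma adj_of_del2 X a b :
  cycles_ge #|X| -> induced_connected G X ->
  (forall y, induced_connected G (X :\ y)) -> 2 < #|X| ->
  a \in X -> b \in X -> a != b ->
  induced_connected G (X :\: [set a; b]) -> adj G a b.
Proof.
move=> gX cX cXd X2 aX bX ab cD; apply/negPn/negP => nab.
have [w [w' [wX w'X ww' aw aw']]] := two_nbrs cX cXd X2 aX.
have inD y : y \in X -> adj G a y -> y \in X :\: [set a; b].
  move=> yX ay; rewrite !inE yX andbT negb_or eq_sym adj_neq //=.
  by apply: contraNneq nab => <-.
move/eqP: ww'; apply.
apply: (cycles_ge_unique_nbr gX cD _ _ (inD _ wX aw) (inD _ w'X aw') aw aw').
  rewrite cardsD (setIidPr _) ?cards2 ?ab; last by rewrite subUset !sub1set aX.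
  by lia.
by rewrite !inE eqxx.
Qed.

End OneGraph.

(** * Graphs with the same connected sets of size at least [k] *)

Lemma sgraph_eq (V : finType) (G H : sgraph V) : adj G =2 adj H -> G = H.
Proof.
case: G H => [E hE] [F hF] eqEF.
have eEF : E = F.
  apply/setP => e; apply/idP/idP => he.
    have /cards2P[x [y [_ exy]]] := forall_inP hE _ he.
    by move: he; rewrite exy; have := eqEF x y; rewrite /adj /= => ->.
  have /cards2P[x [y [_ exy]]] := forall_inP hF _ he.
  by move: he; rewrite exy; have := eqEF x y; rewrite /adj /= => ->.
by subst F; rewrite (bool_irrelevance hE hF).
Qed.

Definition agree_ge (V : finType) (G H : sgraph V) (k : nat) : Prop :=
  forall X : {set V}, k <= #|X| -> induced_connected G X = induced_connected H X.

Lemma agree_ge_sym (V : finType) (G H : sgraph V) k : agree_ge G H k -> agree_ge H G k.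
Proof. by move=> aGH X kX; rewrite aGH. Qed.

Section TwoGraphs.
Variables (V : finType).
Implicit Types (G H : sgraph V) (x y z a b v w s t : V) (X Y S D : {set V}).
Implicit Types (c p q : seq V) (k m : nat).

(* Every edge of G[X] lies in a connected k-subset of X. *)
Lemma ksets_connected_sub G H k X :
  1 < k -> connected_ksets G k = connected_ksets H k -> k <= #|X| ->
  induced_connected G X -> induced_connected H X.
Proof.
move=> k1 eqk kX cX; have /induced_connectedP[/set0Pn[x xX] cGX] := cX.
apply: (@induced_connected_root _ _ _ x xX) => y yX.
apply: connect_sub (cGX _ _ xX yX) => a b /and3P[aX bX ab].
have cab := induced_connectedU1 (induced_connected1 G a) (set11 a) ab.
have [||K [sK KX Kk cK]] := grow_connected (m := k) cX cab.
- by rewrite subUset !sub1set aX bX.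
- by rewrite cardsU1 cards1 kX; case: (_ \notin _); rewrite ?andbT //; lia.
have : K \in connected_ksets H k by rewrite -eqk inE Kk eqxx.
rewrite inE => /andP[_ /induced_connectedP[_ cHK]].
apply: sub_connect_induced KX _; apply: cHK; apply: (subsetP sK).
  by rewrite !inE eqxx orbT.
by rewrite !inE eqxx.
Qed.

Lemma ksets_agree_ge G H k :
  1 < k -> connected_ksets G k = connected_ksets H k -> agree_ge G H k.
Proof.
by move=> k1 eqk X kX; apply/idP/idP; apply: ksets_connected_sub kX.
Qed.

(** * Forests *)

(** An edge leaving the component can only end at [b], since any other end would belong to the
    component. *)
Lemma component_nbr G b x :
  connected_graph G -> b != x ->
  exists2 s, s \in component G (~: [set b]) x & adj G s b.
Proof.
move=> cG bx; have xb : x \in ~: [set b] by rewrite !inE eq_sym.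
have sb := component_sub G xb.
have [||| s [t [sC _ tC st]]] := @crossing_edge _ _ _ (component G (~: [set b]) x) cG.
- exact: subsetT.
- by apply/set0Pn; exists x; apply: component_refl.
- apply/negP => /eqP eT; have := subsetP sb b.
  by rewrite eT !inE eqxx => /(_ isT).
exists s => //; have [<- //|tb] := eqVneq t b.
by case/negP: tC; apply: component_closed sC _ st; rewrite // !inE.
Qed.

(* The pair (r, b) is chosen to maximise the component of r in G - b among the
   components with fewer than k vertices; the component of b in G - b' is then
   either larger or covers the complement of the former. *)
Lemma centroid G k :
  connected_graph G -> 0 < k -> 2 * k - 1 <= #|V| ->
  exists r, forall b, b != r -> k <= #|component G (~: [set b]) r|.
Proof.
move=> cG k0 hV.
pose small (u : V * V) := (u.2 != u.1) && (#|component G (~: [set u.2]) u.1| < k).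
have [/existsP[r /forall_inP hr]|] :=
  boolP [exists r, forall (b | b != r), k <= #|component G (~: [set b]) r|].
  by exists r.
rewrite negb_exists => /forallP no_r.
have ex_small r : exists b, small (r, b).
  have := no_r r; rewrite negb_forall => /existsP[b].
  by rewrite negb_imply -ltnNge => hb; exists b.
have [r0 _] : exists r0 : V, true.
  by have /card_gt0P[r0 _] : 0 < #|V| by lia; exists r0.
have [b0 small0] := ex_small r0.
case: (@arg_maxnP _ (r0, b0) small (fun u => #|component G (~: [set u.2]) u.1|) small0).
move=> [r b] /andP[/= br Dk] Dmax.
set D := component G (~: [set b]) r in Dk Dmax.
have rb : r \in ~: [set b] by rewrite !inE eq_sym.
have bD : b \notin D.
  by apply/negP => /(subsetP (component_sub G rb)); rewrite !inE eqxx.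
have Dclosed s t : s \in D -> t \notin D -> adj G s t -> t = b.
  move=> sD tD st; apply/eqP; apply: contraNT tD => tb.
  by apply: component_closed sD _ st; rewrite // !inE.
have [s sD sb] := component_nbr cG br.
have [b' sm'] := ex_small b.
have /andP[/= b'b D'k] := sm'.
(* If [b'] lies outside [D], then [b |: D] is connected and avoids [b'], giving a small component
   larger than [D]. *)
have [b'D|b'D] := boolP (b' \in D); last first.
  have cbD := induced_connectedU1 (component_connected G rb) sD sb.
  have /subset_leq_card : b |: D \subset component G (~: [set b']) b.
    apply: component_max cbD (setU11 _ _) _.
    apply/subsetP => z zbD; rewrite !inE; apply: contraTneq zbD => ->.
    by rewrite in_setU1 negb_or b'b.
  by rewrite cardsU1 bD add1n; have /= := Dmax _ sm'; case: ltngtP.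
(* Edges leave [D] only towards [b], so [E] is all of [~: D]. It avoids [b'], so [D] and [E] both
   have fewer than [k] vertices, against [2 * k - 1 <= #|V|]. *)
pose E := component G (~: D) b.
have bD' : b \in ~: D by rewrite inE.
have ED : E \subset ~: D := component_sub G bD'.
have EDT : E :|: D = [set: V].
  apply/eqP/negPn/negP => nT.
  have [|||u [t [uED _ tED ut]]] := @crossing_edge _ _ _ (E :|: D) cG.
  - exact: subsetT.
  - by apply/set0Pn; exists b; rewrite inE component_refl.
  - by [].
  move: tED; rewrite inE => /norP[/negP tE tD]; apply: tE.
  move: uED; rewrite inE => /orP[uE|uD].
    by apply: component_closed uE _ ut; rewrite // inE.
  by rewrite (Dclosed _ _ uD tD ut) component_refl.
have /subset_leq_card : E \subset component G (~: [set b']) b.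
  apply: component_max (component_connected G bD') (component_refl _ _ _) _.
  apply: subset_trans ED _; apply/subsetP => z; rewrite !in_setC in_set1.
  by apply: contraNneq => ->.
have VED : #|V| <= #|E| + #|D| by rewrite -cardsT -EDT cardsU leq_subr.
move=> /leq_ltn_trans/(_ D'k); move: #|E| #|D| #|V| hV k0 Dk VED {Dmax}; clear.
by lia.
Qed.

Lemma component_agree_sub G H k r b :
  agree_ge G H k -> b != r -> k <= #|component G (~: [set b]) r| ->
  component G (~: [set b]) r \subset component H (~: [set b]) r.
Proof.
move=> aGH br kC; have rb : r \in ~: [set b] by rewrite !inE eq_sym.
apply: component_max; rewrite ?component_refl ?component_sub //.
by rewrite -aGH // component_connected.
Qed.

(** One inclusion gives the component in [H] at least [k] vertices too, so the graphs can be
    exchanged. *)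
Lemma component_agree G H k r b :
  agree_ge G H k -> b != r -> k <= #|component G (~: [set b]) r| ->
  component G (~: [set b]) r = component H (~: [set b]) r.
Proof.
move=> aGH br kC; have sGH := component_agree_sub aGH br kC.
apply/eqP; rewrite eqEsubset sGH.
apply: component_agree_sub (agree_ge_sym aGH) br _.
exact: leq_trans kC (subset_leq_card sGH).
Qed.

(** Rooted at [r], two vertices cannot each lie below the other: if [y] cuts [x] off from [r], the
    component of [r] without [y], together with [y], is connected and avoids [x]. *)
Lemma component_or G r x y :
  connected_graph G -> x != y ->
  (y != r /\ x \in component G (~: [set y]) r) \/
  (x != r /\ y \in component G (~: [set x]) r).
Proof.
move=> cG xy.
have [er|xr] := eqVneq x r; first by left; rewrite -er component_refl eq_sym.
have [->|yr] := eqVneq y r; first by right; rewrite component_refl.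
have [xC|xC] := boolP (x \in component G (~: [set y]) r); first by left.
right; split=> //.
have [s sC sy] := component_nbr cG yr.
have ry : r \in ~: [set y] by rewrite !inE eq_sym.
have cyC := induced_connectedU1 (component_connected G ry) sC sy.
apply: (subsetP (component_max cyC _ _)); rewrite ?setU11 //.
  by rewrite inE component_refl orbT.
apply/subsetP => z; rewrite !inE => /predU1P[->|]; first by rewrite eq_sym.
by apply: contraTneq => ->; rewrite inE in xC.
Qed.

(** Here [x] is the parent of [y]. If [r] reached [y] avoiding [x], the last vertex [s] before [y]
    and [x] would be two neighbours of [y] in the component of [r] without [y], closing a cycle. *)
Lemma parent_separates G r x y :
  connected_graph G -> cycles_ge G #|V|.+1 -> y != r ->
  x \in component G (~: [set y]) r -> adj G x y -> x != r ->
  y \notin component G (~: [set x]) r.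
Proof.
move=> cG gG yr xA xy xr; apply/negP => yA.
have ry : r \in ~: [set y] by rewrite !inE eq_sym.
have rx : r \in ~: [set x] by rewrite !inE eq_sym.
set Ax := component G (~: [set x]) r in yA.
have rE : r \in Ax :\ y by rewrite !inE eq_sym yr connect0.
pose E := component G (Ax :\ y) r.
have EA : E \subset Ax :\ y := component_sub G rE.
have [|||s [t [sE tA tE st]]] := @crossing_edge _ _ _ E (component_connected G rx).
- exact: subset_trans EA (subsetDl _ _).
- by apply/set0Pn; exists r; apply: component_refl.
- apply/negP => /eqP eA; have := subsetP EA y.
  by rewrite eA in_setD1 eqxx => /(_ yA).
have ty : t = y.
  apply/eqP; apply: contraNT tE => ty.
  by apply: component_closed sE _ st; rewrite // in_setD1 ty.
rewrite {}ty in st.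
have sA : s \in component G (~: [set y]) r.
  apply: (subsetP _ s sE); apply: component_max (component_connected G rE) _ _.
    exact: component_refl.
  by apply: subset_trans EA _; apply/subsetP => z; rewrite !inE => /andP[].
have yA' : y \notin component G (~: [set y]) r.
  by apply/negP => /(subsetP (component_sub G ry)); rewrite !inE eqxx.
have sx : s = x.
  apply: (cycles_ge_unique_nbr gG (component_connected G ry) _ yA' sA xA).
  - have := max_card (mem (y |: component G (~: [set y]) r)).
    by rewrite cardsU1 yA' add1n ltnS.
  - by rewrite adj_sym.
  - by rewrite adj_sym.
have /setD1P[_ sAx] := subsetP EA s sE.
by have := subsetP (component_sub G rx) s sAx; rewrite sx !inE eqxx.
Qed.

(** Let [p] be the parent of [y] in [H]. If [p != x], one of them can be avoided on the way from [r]
    to the other and on to [y], although it separates [y] from [r] in its own graph; the components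
    are common to both. *)
Lemma forest_parent G H r x y :
  connected_graph G -> connected_graph H ->
  cycles_ge G #|V|.+1 -> cycles_ge H #|V|.+1 ->
  (forall b, b != r -> component G (~: [set b]) r = component H (~: [set b]) r) ->
  y != r -> x \in component G (~: [set y]) r -> adj G x y -> adj H x y.
Proof.
move=> cG cH gG gH eA yr xA xy.
have [p pA py] := component_nbr cH yr.
have [->//|xp] := eqVneq x p.
have py' := adj_neq py; have xy' := adj_neq xy.
have [[pr xAp]|[xr pAx]] := component_or r cG xp.
  have rp : r \in ~: [set p] by rewrite !inE eq_sym.
  case/negP: (parent_separates cH gH yr pA py pr); rewrite -eA //.
  by apply: component_closed xAp _ xy; rewrite // !inE eq_sym.
have rx : r \in ~: [set x] by rewrite !inE eq_sym.
case/negP: (parent_separates cG gG yr xA xy xr); rewrite eA // in pAx *.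
by apply: component_closed pAx _ py; rewrite // !inE eq_sym.
Qed.

Lemma forest_adj_sub G H k x y :
  connected_graph G -> connected_graph H ->
  cycles_ge G #|V|.+1 -> cycles_ge H #|V|.+1 ->
  0 < k -> 2 * k - 1 <= #|V| -> agree_ge G H k -> adj G x y -> adj H x y.
Proof.
move=> cG cH gG gH k0 hV aGH xy.
have [r hr] := centroid cG k0 hV.
have eA b : b != r -> component G (~: [set b]) r = component H (~: [set b]) r.
  by move=> br; apply: component_agree aGH br (hr b br).
have [[yr xA]|[xr yA]] := component_or r cG (adj_neq xy).
  exact: forest_parent cG cH gG gH eA yr xA xy.
rewrite adj_sym; apply: forest_parent cG cH gG gH eA xr yA _.
by rewrite adj_sym.
Qed.

(** * Graphs with a cycle *)

Lemma path_consecutive (e : rel V) y q :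
  (forall p1 a b p2, y :: q = p1 ++ [:: a, b & p2] -> e a b) -> path e y q.
Proof.
elim: q y => //= z q IHq y he; rewrite (he [::] y z q) //=.
by apply: IHq => p1 a b p2 E; apply: (he (y :: p1) a b p2); rewrite E.
Qed.

Lemma card_ucycle G c : ucycle (adj G) c -> #|[set y in c]| = size c.
Proof. by case/andP => _ /card_uniqP <-; rewrite cardsE. Qed.

Lemma card_del2 X a b : a \in X -> b \in X -> a != b -> #|X :\: [set a; b]|.+2 = #|X|.
Proof.
move=> aX bX ab; rewrite [#|X|](cardsD1 a) aX (cardsD1 b (X :\ a)).
by rewrite !inE eq_sym ab bX !add1n setDDl.
Qed.

(** [adj_of_del2] makes a consecutive pair of [c] adjacent in [H] once [C] without the pair is known
    to be connected in [H]. *)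
Lemma cycle_transfer G H k m c :
  4 <= k -> 2 * k - 1 <= #|V| -> connected_graph G -> agree_ge G H k ->
  cycles_ge G m -> cycles_ge H m -> k < m ->
  ucycle (adj G) c -> size c = m -> ucycle (adj H) c.
Proof.
move=> k4 hV cG aGH gG gH km uc cm; have /andP[_ Uc] := uc.
rewrite /ucycle Uc andbT; set C := [set y in c].
have cardC : #|C| = m by rewrite (card_ucycle uc).
have m4 : 4 < m by apply: leq_ltn_trans km.
have sz i : size (rot i c) = m by rewrite size_rot.
have cGC : induced_connected G C by apply: ucycle_connected; rewrite // cm; apply: ltn_trans m4.
have cHC : induced_connected H C by rewrite -aGH // cardC ltnW.
have C2 : 2 < #|C| by rewrite cardC; apply: ltn_trans m4.
have cardC1 a : k <= #|C :\ a|.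
  by rewrite -ltnS; apply: leq_trans km _; rewrite -cardC (cardsD1 a C) -add1n leq_add2r leq_b1.
have cGC1 a : induced_connected G (C :\ a).
  by apply: ucycle_del1; rewrite // cm; apply: ltn_trans m4.
have cHC1 a : induced_connected H (C :\ a) by rewrite -aGH.
have key a b : a \in C -> b \in C -> a != b ->
    induced_connected H (C :\: [set a; b]) -> adj H a b.
  by apply: adj_of_del2 => //; rewrite cardC.
have consec p1 a b p2 i : rot i c = p1 ++ [:: a, b & p2] ->
    [/\ a \in C, b \in C, a != b & induced_connected G (C :\: [set a; b])].
  move=> rc.
  have Er y : (y \in c) = (y \in p1 ++ [:: a, b & p2]) by rewrite -rc mem_rot.
  have EC : C = [set y in p1 ++ [:: a, b & p2]] by apply/setP => y; rewrite !inE Er.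
  split.
  - by rewrite inE Er mem_cat mem_head orbT.
  - by rewrite inE Er mem_cat !inE eqxx !orbT.
  - move: Uc; rewrite -(rot_uniq i) rc cat_uniq => /and3P[_ _ /= /andP[]].
    by rewrite inE => /norP[].
  - rewrite EC; apply: ucycle_del2; first by rewrite -rc rot_ucycle.
    by have := sz i; rewrite rc !size_cat /=; move: m4; clear; lia.
have [mk|mk] := leqP (k + 2) m.
  apply: cycle_from_next => // a /rot_to[i [|b p] rc].
    by have := sz i; rewrite rc => /= m1; rewrite -m1 in m4.
  have -> : next c a = b by rewrite -(next_rot i Uc) rc /= eqxx.
  have [aC bC ab cab] := consec [::] a b p i rc.
  apply: key => //; rewrite -aGH // -2!ltnS card_del2 // cardC.
  by rewrite -addn2.
(* Deleting a pair now leaves only [k - 1] vertices, one too few for agreement. A vertex [v]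
   attached to [C] at [x] makes up for it; it exists because [k + 1 < 2 * k - 1]. *)
have {}mk : m = k.+1 by move: mk km; clear; lia.
have [|||x [v [xC _ vC xv]]] := @crossing_edge _ _ _ C cG.
- exact: subsetT.
- by rewrite -card_gt0; apply: ltn_trans C2.
- by apply: contraTneq hV => CT; rewrite -cardsT -CT cardC mk; move: k4; clear; lia.
have vc : v \notin c by move: vC; rewrite inE.
have vx : adj G v x by rewrite adj_sym.
have cGv := induced_connectedU1 cGC xC xv.
(* H[C] is a cycle as well, possibly in another order at this point. *)
have [c' [uc' c'm EC']] : exists c', [/\ ucycle (adj H) c', size c' = m & [set y in c'] = C].
  have [w [w' [wC w'C ww' xw xw']]] := two_nbrs cHC cHC1 C2 xC.
  have nbrC y : y \in C -> adj H x y -> y \in C :\ x.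
    by move=> yC xy; rewrite in_setD1 yC andbT eq_sym (adj_neq xy).
  have [|c' [uc' /andP[c3 cC] sc']] :=
    two_nbr_cycle (cHC1 x) _ (nbrC _ wC xw) (nbrC _ w'C xw') ww' xw xw'.
    by rewrite in_setD1 eqxx.
  have mc' := cycles_ge_size gH uc' c3.
  have cc' : [set y in c'] \subset C.
    by apply/subsetP => y; rewrite inE => /sc'; rewrite setD1K.
  have E : [set y in c'] = C.
    by apply/eqP; rewrite eqEcard cc' (card_ucycle uc') cardC.
  by exists c'; split=> //; rewrite -(card_ucycle uc') E.
have uniqG y : y \in C -> adj G v y -> y = x.
  rewrite inE => yc vy.
  by apply: (ucycle_unique_nbr gG m4 uc cm vc yc _ vy vx); rewrite inE in xC.
have vc' : v \notin c' by move: vC; rewrite -EC' inE.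
have uniqH y z : y \in C -> z \in C -> adj H v y -> adj H v z -> y = z.
  by rewrite -EC' !inE; apply: (ucycle_unique_nbr gH m4 uc' c'm vc').
have cHv : induced_connected H (v |: C).
  by rewrite -aGH // cardsU1 vC cardC add1n ltnW // ltnW.
have cardCv X : X \subset C -> #|v |: X| = #|X|.+1.
  by move=> XC; rewrite cardsU1 (contra (subsetP XC v)).
(* If [v] had another neighbour [y] of [C] in [H], then [v |: (C :\ x)] would be connected in [H],
   hence in [G], where [x] is the only neighbour of [v] in [C]. *)
have vxH : adj H v x.
  have [|y] := nbr_in_connected cHv (setU11 v C).
    by rewrite cardCv // cardC ltnS; apply: leq_trans m4.
  rewrite in_setU1 => /predU1P[->|yC] vy; first by have := adj_neq vy; rewrite eqxx.
  have [<-//|yx] := eqVneq y x.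
  have : induced_connected H (v |: (C :\ x)).
    by apply: (induced_connectedU1 (s := y)); rewrite ?in_setD1 ?yx // adj_sym.
  rewrite -aGH; last by rewrite cardCv ?subsetDl // ltnW // ltnS.
  move=> cvx; have [|z] := nbr_in_connected cvx (setU11 v _).
    by rewrite cardCv ?subsetDl // ltnS; apply: leq_trans (cardC1 x); apply: ltn_trans k4.
  rewrite !in_setU1 in_setD1 => /predU1P[->|/andP[zx zC]] vz.
    by have := adj_neq vz; rewrite eqxx.
  by rewrite (uniqG z zC vz) eqxx in zx.
have xc : x \in c by rewrite inE in xC.
have [i [|y q] rc] := rot_to xc.
  by have := sz i; rewrite rc => /= m1; rewrite -m1 in m4.
have Ur : uniq [:: x, y & q] by rewrite -rc rot_uniq.
have pH : path (adj H) y q.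
  apply: path_consecutive => p1 a b p2 E.
  have {}E : rot i c = (x :: p1) ++ [:: a, b & p2] by rewrite rc E.
  have [aC bC ab cGab] := consec _ _ _ _ _ E; apply: key => //.
  have xab : x \in C :\: [set a; b].
    have : x \notin p1 ++ [:: a, b & p2] by move: Ur; rewrite -rc E => /andP[].
    rewrite mem_cat !inE !negb_or => /andP[_ /and3P[-> -> _]].
    by rewrite inE in xC.
  have subC : C :\: [set a; b] \subset C by apply: subsetDl.
  have : induced_connected H (v |: C :\: [set a; b]).
    rewrite -aGH; first exact: induced_connectedU1 cGab xab xv.
    by rewrite cardCv // -ltnS card_del2 // cardC mk.
  (* Removing [v] keeps the set connected in [H]: its only neighbour there is [x], so no edge leaves
     [v |: E0]. *)
  move=> cD; pose E0 := component H (C :\: [set a; b]) x.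
  have E0sub : E0 \subset C :\: [set a; b] := component_sub H xab.
  have [/eqP eE|nE] := boolP (v |: E0 == v |: (C :\: [set a; b])).
    suff <- : E0 = C :\: [set a; b] by apply: component_connected.
    apply/eqP; rewrite eqEsubset E0sub; apply/subsetP => z zD.
    have : z \in v |: E0 by rewrite eE in_setU1 zD orbT.
    rewrite in_setU1 => /predU1P[zv|//].
    by move: (subsetP subC z zD); rewrite zv (negbTE vC).
  have [||s [t [sE]]] := crossing_edge cD _ _ nE.
  - exact: setUS.
  - by apply/set0Pn; exists v; apply: setU11.
  rewrite in_setU1 => /predU1P[->|tD]; first by rewrite setU11.
  rewrite in_setU1 => /norP[_ /negP tE] st; case: tE.
  move: sE; rewrite in_setU1 => /predU1P[sv|sE].
    rewrite {}sv in st.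
    by rewrite (uniqH t x (subsetP subC t tD) xC st vxH) component_refl.
  exact: component_closed sE tD st.
have inC z : (z \in C) = (z \in [:: x, y & q]) by rewrite inE -rc mem_rot.
(* The two remaining edges meet [x]; deleting [x] and the other end leaves a subpath of [y :: q],
   connected in [H] by [pH]. *)
rewrite -(rot_cycle i) rc /= rcons_path pH /=; apply/andP; split.
  apply: key; rewrite ?inC ?inE ?eqxx ?orbT //.
    by move: Ur => /= /andP[]; rewrite inE => /norP[].
  suff -> : C :\: [set x; y] = [set z in q].
    case: q pH rc {inC Ur} => [_ rc|z r /= /andP[_ pr] _]; last exact: path_connected.
    by have := sz i; rewrite rc => /= m1; rewrite -m1 in m4.
  apply/setP => z; rewrite in_setD inC !inE.
  move: Ur => /= /and3P[]; rewrite inE => /norP[_ xq] yq _.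
  case: eqVneq => [->|_] /=; first by rewrite (negbTE xq).
  by case: eqVneq => [->|_] //=; rewrite (negbTE yq).
case/lastP: q rc Ur pH inC => [|r z] rc Ur pH inC.
  by have := sz i; rewrite rc => /= m1; rewrite -m1 in m4.
rewrite last_rcons adj_sym; apply: key.
- by [].
- by rewrite inC !inE mem_rcons mem_head !orbT.
- by move: Ur => /= /andP[]; rewrite inE mem_rcons inE => /norP[_ /norP[]].
suff -> : C :\: [set x; z] = [set u in y :: r].
  by move: pH; rewrite rcons_path => /andP[/path_connected].
move: Ur; rewrite -2!rcons_cons rcons_uniq cons_uniq => /and3P[zn xn _].
apply/setP => u; rewrite in_setD inC !inE mem_rcons !inE.
case: eqVneq => [->|_] /=; first by move: xn; rewrite inE => /negbTE.
case: eqVneq => [->|_] //=; by move: zn; rewrite !inE => /norP[_ /negbTE].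
Qed.

(** A cycle whose length is at most the girth has no chord: otherwise [a] would have two neighbours
    on a path of [m - 2] vertices. So the edge lies on [c]. *)
Lemma common_cycle_adj G H m c a b :
  cycles_ge G m -> 4 < m -> ucycle (adj G) c -> ucycle (adj H) c -> size c = m ->
  a \in c -> b \in c -> adj G a b -> adj H a b.
Proof.
move=> gG m4 ucG ucH cm ac bc ab; have ab' := adj_neq ab.
have [i [|y q] rc] := rot_to ac; have sz : size (rot i c) = m by rewrite size_rot.
  by rewrite rc /= in sz; rewrite -sz in m4.
rewrite rc in sz.
have {}ucG : ucycle (adj G) [:: a, y & q] by rewrite -rc rot_ucycle.
have {ucH} /andP[cH _] : ucycle (adj H) [:: a, y & q] by rewrite -rc rot_ucycle.
have : b \in [:: a, y & q] by rewrite -rc mem_rot.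
rewrite inE eq_sym (negbTE ab') /= inE => /predU1P[->|bq].
  by move: cH => /= /andP[].
case/lastP: q bq ucG cH sz {rc} => // q z bq ucG cH sz.
move: bq; rewrite mem_rcons inE => /predU1P[->|bq].
  by move: cH; rewrite /= rcons_path last_rcons => /and3P[_ _]; rewrite adj_sym.
have := ucycle_path erefl ucG; rewrite rcons_path => /andP[/path_connected cD _].
have /andP[cG Uc] := ucG.
have ay : adj G a y by move: cG => /= /andP[].
move: Uc; rewrite -rcons_cons cons_uniq mem_rcons inE negb_or.
move=> /andP[/andP[_ aD] Uq].
have yb : y = b.
  apply: (cycles_ge_unique_nbr gG cD _ _ _ _ ay ab); rewrite ?inE ?eqxx ?bq ?orbT //.
  rewrite cardsE; apply: leq_ltn_trans (_ : (size (y :: q)).+1 < m); first exact: card_size.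
  by rewrite -sz /= size_rcons.
move: Uq; rewrite rcons_uniq cons_uniq yb bq /=.
by rewrite andbF.
Qed.

Lemma connected_of_adj_eq G H X :
  {in X &, adj G =2 adj H} -> induced_connected G X -> induced_connected H X.
Proof.
move=> eqX /induced_connectedP[X0 cX]; apply/induced_connectedP; split=> // x y xX yX.
apply: connect_sub (cX x y xX yX) => a b /and3P[aX bX ab].
by apply: connect1; rewrite /induced_adj aX bX -eqX.
Qed.

(** Otherwise remove from [c] the neighbour of [v] in [H], if there is one. The rest [E] contains
    [z] and has at least [k] vertices; [v |: E] is connected in [G] but not in [H]. *)
Lemma extend_on_cycle G H k m c v z :
  agree_ge G H k -> cycles_ge H m -> 4 < m -> 0 < k < m ->
  ucycle (adj G) c -> ucycle (adj H) c -> size c = m -> v \notin c -> z \in c ->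
  adj G v z -> adj H v z.
Proof.
move=> aGH gH m4 /andP[k0 km] ucG ucH cm vc zc vz; apply/negPn/negP => nvz.
have [E [sE cE kE zE]] : exists E : {set V}, [/\ forall y, y \in E -> y \in c /\ ~~ adj H v y,
    induced_connected G E, k <= #|E| & z \in E].
  have cardC : #|[set y in c]| = m by rewrite (card_ucycle ucG).
  have [/hasP[w wc vw]|/hasPn nw] := boolP (has (adj H v) c).
    exists ([set y in c] :\ w); split.
    - move=> y; rewrite !inE => /andP[yw yc]; split=> //; apply: contra yw => vy.
      by rewrite (ucycle_unique_nbr gH m4 ucH cm vc yc wc vy vw).
    - by apply: ucycle_del1; rewrite // cm; apply: ltn_trans m4.
    - by move: km; rewrite -cardC (cardsD1 w) inE wc.
    - by rewrite !inE zc andbT; apply: contraNneq nvz => ->.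
  exists [set y in c]; split.
  - by move=> y; rewrite inE => yc; split=> //; apply: nw.
  - by apply: ucycle_connected; rewrite // cm; apply: ltn_trans m4.
  - by rewrite cardC ltnW.
  - by rewrite inE.
have vE : v \notin E by apply/negP => /sE[]; rewrite (negbTE vc).
have cardvE : #|v |: E| = #|E|.+1 by rewrite cardsU1 vE.
have cv : induced_connected H (v |: E).
  rewrite -aGH ?cardvE 1?ltnW //; apply: induced_connectedU1 cE zE _.
  by rewrite adj_sym.
have [|y] := nbr_in_connected cv (setU11 v E).
  by rewrite cardvE ltnS; apply: leq_trans kE.
rewrite in_setU1 => /predU1P[->|/sE[_ /negP]] // vv.
by have := adj_neq vv; rewrite eqxx.
Qed.

(** [v |: Y] is connected in [H], so [v] has a neighbour [y] in [Y] for [H]. If [y != z], then [y]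
    and [z] are two neighbours of [v] in [Y] for [G], against the girth. *)
Lemma extend_along G H k m Y v z :
  agree_ge G H k -> cycles_ge G m -> 1 < k < m ->
  induced_connected G Y -> #|Y|.+1 = k -> v \notin Y -> z \in Y ->
  {in Y, forall y, y != z -> adj G v y = adj H v y} ->
  adj G v z -> adj H v z.
Proof.
move=> aGH gG /andP[k1 km] cY Yk vY zY eqY vz.
have cardvY : #|v |: Y| = k by rewrite cardsU1 vY.
have cv : induced_connected H (v |: Y).
  rewrite -aGH ?cardvY //; apply: induced_connectedU1 cY zY _.
  by rewrite adj_sym.
have [|y] := nbr_in_connected cv (setU11 v Y); first by rewrite cardvY.
rewrite in_setU1 => /predU1P[->|yY] vy; first by have := adj_neq vy; rewrite eqxx.
have [<-//|yz] := eqVneq y z.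
have vyG : adj G v y by rewrite eqY.
move/eqP: yz; case; apply: (cycles_ge_unique_nbr gG cY _ vY yY zY vyG vz).
by rewrite Yk.
Qed.

(* If v has different neighbours in X for G and H, none of the differing ones is on c,
   and one of them is joined to c inside X avoiding all others. *)
Lemma extend_agreement G H k m c X v :
  3 < k < m -> agree_ge G H k -> cycles_ge G m -> cycles_ge H m ->
  ucycle (adj G) c -> ucycle (adj H) c -> size c = m ->
  [set y in c] \subset X -> induced_connected G X -> {in X &, adj G =2 adj H} ->
  v \notin X -> {in X, adj G v =1 adj H v}.
Proof.
move=> /andP[k3 km] aGH gG gH ucG ucH cm cX conX eqX vX.
have m4 : 4 < m by apply: leq_ltn_trans km.
have k0m : 0 < k < m by rewrite km andbT; apply: ltn_trans k3.
have k1m : 1 < k < m by rewrite km andbT; apply: ltn_trans k3.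
have vc : v \notin c by apply: contra vX => vc; apply: (subsetP cX); rewrite inE.
pose diff := [set z in X | adj G v z != adj H v z].
have cdiff z : z \in c -> z \notin diff.
  move=> zc; rewrite inE negb_and negbK; apply/orP; right; apply/eqP; apply/idP/idP.
    exact: extend_on_cycle aGH gH m4 k0m ucG ucH cm vc zc.
  exact: extend_on_cycle (agree_ge_sym aGH) gG m4 k0m ucH ucG cm vc zc.
have [d0 z zX|/set0Pn[d dX]] := eqVneq diff set0.
  have : z \notin diff by rewrite d0 inE.
  by rewrite inE zX negbK => /eqP.
have cC : induced_connected G [set y in c].
  by apply: ucycle_connected; rewrite // cm; apply: ltn_trans m4.
have /induced_connectedP[/set0Pn[r rC] _] := cC.
have rD : r \in X :\: diff.
  by rewrite inE (subsetP cX) // andbT cdiff //; rewrite inE in rC.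
(* [W] is what the cycle reaches within [X] avoiding [diff]; an edge of [G[X]] leaving [W] ends at
   some [t] in [diff]. *)
pose W := component G (X :\: diff) r.
have WD : W \subset X :\: diff := component_sub G rD.
have CW : [set y in c] \subset W.
  apply: component_max cC rC _; apply/subsetP => y yC.
  by rewrite in_setD (subsetP cX) // andbT cdiff //; rewrite inE in yC.
have [|||s [t [sW tX tW st]]] := @crossing_edge _ _ _ W conX.
- exact: subset_trans WD (subsetDl _ _).
- by apply/set0Pn; exists r; apply: component_refl.
- apply/negP => /eqP eW; have := subsetP WD d; rewrite eW in_setD dX.
  by move: dX; rewrite inE => /andP[-> _] /(_ isT).
have tdiff : t \in diff.
  apply: contraNT tW => tn; apply: component_closed sW _ st => //.
  by rewrite in_setD tn.
have ctW := induced_connectedU1 (component_connected G rD) sW st.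
(* Inside [t |: W] the only vertex of [diff] is [t]. The size [k.-1] makes [v |: Y] a set of exactly
   [k] vertices. *)
have [||Y [tY YW Yk cY]] := grow_connected (m := k.-1) ctW (induced_connected1 G t).
- by rewrite sub1set setU11.
- rewrite cards1 cardsU1 tW (leq_trans _ (leq_trans (subset_leq_card CW) (leq_addl _ _))).
    by rewrite -ltnS prednK ?(ltnW k3) // (ltn_trans _ k3).
  by rewrite (card_ucycle ucG) cm (leq_trans (leq_pred k)) // ltnW.
have {}Yk : #|Y|.+1 = k by rewrite Yk prednK // (ltn_trans _ k3).
have YX : Y \subset X.
  apply: subset_trans YW _; rewrite subUset sub1set tX /=.
  exact: subset_trans WD (subsetDl _ _).
have {}tY : t \in Y by rewrite sub1set in tY.
have vY : v \notin Y by apply: contra vX; apply: (subsetP YX).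
have eqY : {in Y, forall y, y != t -> adj G v y = adj H v y}.
  move=> y /(subsetP YW); rewrite in_setU1 => /predU1P[->|]; first by rewrite eqxx.
  by move/(subsetP WD); rewrite !inE => /andP[+ yX] _; rewrite yX negbK => /eqP.
have eqYH : {in Y, forall y, y != t -> adj H v y = adj G v y}.
  by move=> y yY yt; rewrite eqY.
have cHY : induced_connected H Y.
  by apply: connected_of_adj_eq cY => a b /(subsetP YX) aX /(subsetP YX); apply: eqX.
move: tdiff; rewrite inE => /andP[_ /eqP[]]; apply/idP/idP.
  exact: extend_along aGH gG k1m cY Yk vY tY eqY.
exact: extend_along (agree_ge_sym aGH) gH k1m cHY Yk vY tY eqYH.
Qed.

(** Take a maximal connected set containing [c] on which both graphs agree; a neighbour outside it
    could be added. *)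
Lemma cyclic_adj_eq G H k m c :
  4 <= k -> 2 * k - 1 <= #|V| -> connected_graph G -> agree_ge G H k ->
  cycles_ge G m -> cycles_ge H m -> k < m ->
  ucycle (adj G) c -> size c = m -> adj G =2 adj H.
Proof.
move=> k4 hV cG aGH gG gH km ucG cm.
have ucH := cycle_transfer k4 hV cG aGH gG gH km ucG cm.
have m4 : 4 < m by apply: leq_ltn_trans km.
pose P X := [&& [set y in c] \subset X, induced_connected G X &
  [forall x in X, forall y in X, adj G x y == adj H x y]].
have PC : P [set y in c].
  rewrite /P subxx ucycle_connected ?cm //=; last by apply: ltn_trans m4.
  apply/forall_inP => x; rewrite inE => xc; apply/forall_inP => y; rewrite inE => yc.
  by apply/eqP; apply/idP/idP; apply: (@common_cycle_adj _ _ m c).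
have [X maxX _] := maxset_exists PC.
have /maxsetP[/and3P[cX conX /forall_inP eqX] Xmax] := maxX.
have {}eqX : {in X &, adj G =2 adj H}.
  by move=> x y xX yX; apply/eqP; apply: (forall_inP (eqX x xX)).
have [XT|XT] := eqVneq X [set: V]; first by move=> x y; apply: eqX; rewrite XT inE.
have /induced_connectedP[X0 _] := conX.
have [s [v [sX _ vX sv]]] := crossing_edge cG (subsetT X) X0 XT.
have k3m : 3 < k < m by rewrite k4.
have eqv := extend_agreement k3m aGH gG gH ucG ucH cm cX conX eqX vX.
have : P (v |: X).
  rewrite /P (subset_trans cX) ?subsetUr // (induced_connectedU1 conX sX sv) /=.
  apply/forall_inP => x; rewrite in_setU1 => xvX.
  apply/forall_inP => y; rewrite in_setU1 => yvX; apply/eqP.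
  case/predU1P: xvX => [->|xX]; case/predU1P: yvX => [->|yX].
  - by apply/idP/idP => /adj_neq; rewrite eqxx.
  - exact: eqv.
  - by rewrite adj_sym [RHS]adj_sym eqv.
  - exact: eqX.
move/Xmax => /(_ (subsetUr _ _)) vXX.
by rewrite -vXX setU11 in vX.
Qed.

End TwoGraphs.

(** * Choosing a shortest cycle among both graphs *)

Lemma has_cycle_of_lengthP (V : finType) (G : sgraph V) (l : nat) :
  reflect (has_cycle_of_length G l) [exists c : l.-tuple V, ucycleb (adj G) c].
Proof.
apply: (iffP existsP) => [[c uc]|[c [/eqP cl uc]]]; last by exists (Tuple cl).
by exists c; rewrite size_tuple.
Qed.

Theorem theorem7 (k : nat) (V : finType) (G H : sgraph V)
    (hk : 4 <= k) (hV : 2 * k - 1 <= #|V|)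
    (connG : connected_graph G) (connH : connected_graph H)
    (acycG : forall l : nat, 3 <= l <= k -> ~ has_cycle_of_length G l)
    (acycH : forall l : nat, 3 <= l <= k -> ~ has_cycle_of_length H l)
    (sameksets : connected_ksets G k = connected_ksets H k) :
  G = H.
Proof.
have aGH : agree_ge G H k by apply: ksets_agree_ge sameksets; apply: leq_trans hk.
pose cyc (K : sgraph V) l := [exists c : l.-tuple V, ucycleb (adj K) c].
pose P l := (3 <= l) && (cyc G l || cyc H l).
apply: sgraph_eq.
(* Lengths up to [#|V|] suffice: without a cycle of such a length both graphs are trees. *)
have [/existsP[l0 Pl0]|noP] := boolP [exists l : 'I_#|V|.+1, P l]; last first.
  have noc l : 3 <= l < #|V|.+1 -> ~~ cyc G l /\ ~~ cyc H l.
    move=> /andP[l3 lV]; apply/norP; apply: contra noP => cl.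
    by apply/existsP; exists (Ordinal lV); rewrite /P l3.
  have gG : cycles_ge G #|V|.+1.
    by move=> l /noc[nl _] /has_cycle_of_lengthP; apply/negP.
  have gH : cycles_ge H #|V|.+1.
    by move=> l /noc[_ nl] /has_cycle_of_lengthP; apply/negP.
  have k0 : 0 < k by apply: leq_trans hk.
  move=> x y; apply/idP/idP.
    exact: forest_adj_sub connG connH gG gH k0 hV aGH.
  exact: forest_adj_sub connH connG gH gG k0 hV (agree_ge_sym aGH).
have exP : exists l, P l by exists l0.
case: (ex_minnP exP) => m /andP[m3 cm] mmin.
have noc l : 3 <= l < m -> ~~ cyc G l /\ ~~ cyc H l.
  move=> /andP[l3 lm]; apply/norP.
  by apply/negP => cl; have := mmin l; rewrite /P l3 cl => /(_ isT); rewrite leqNgt lm.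
have gG : cycles_ge G m by move=> l /noc[nl _] /has_cycle_of_lengthP; apply/negP.
have gH : cycles_ge H m by move=> l /noc[_ nl] /has_cycle_of_lengthP; apply/negP.
have km : k < m.
  rewrite ltnNge; apply/negP => mk.
  by case/orP: cm => /has_cycle_of_lengthP; [apply: acycG|apply: acycH]; rewrite m3.
case/orP: cm => /has_cycle_of_lengthP[c [cm uc]].
  exact: cyclic_adj_eq hk hV connG aGH gG gH km uc cm.
have e := cyclic_adj_eq hk hV connH (agree_ge_sym aGH) gH gG km uc cm.
by move=> x y; rewrite e.
Qed.
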